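(* Let $A\in\mathbb{R}^{n\times n}$ be symmetric positive definite, and let $0<k<n$ be a fixed integer. Let $A_k^*\in\mathbb{R}^{k\times k}$ be a principal submatrix of $A$ that maximizes $\log\mathrm{vol}(B)$ among all principal submatrices $B\in\mathbb{R}^{k\times k}$ of $A$. Then the strong rank-revealing Cholesky selection algorithm with relaxation factor $\eta>1$ is a 1-interchange algorithm with additive relaxation factor $\theta_a=\log\sqrt\eta$ for maximizing the log-volume, and its output matrix $A_k\equiv A[\mathcal{S}]$ satisfies $$0\le\log\mathrm{vol}(A_k^* )-\log\mathrm{vol}(A_k)\le\frac{k-1}{2k-1}\log\mathrm{vol}\bigl(A_k^*/\lambda_n(A)\bigr)+\frac{k^2}{2k-1}\log\sqrt\eta,$$ where $\frac{k-1}{2k-1}<\frac12$ and $\frac{k^2}{2k-1}\le k$.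
   Context: $\lambda_1(A)\ge\cdots\ge\lambda_n(A)$ are the eigenvalues of $A$. For $\mathcal{S}\subset\{1,\ldots,n\}$, $A[\mathcal{S}]$ is the principal submatrix of $A$ with rows and columns indexed by $\mathcal{S}$. For a square matrix $B$, $\mathrm{vol}(B)=|\det(B)|$. Strong rank-revealing Cholesky selection. Input: symmetric positive semi-definite $A\in\mathbb{R}^{n\times n}$, integer $0<k\le\mathrm{rank}(A)$, relaxation factor $\eta\ge1$. Start with any $\mathcal{S}\subset\{1,\ldots,n\}$ with $|\mathcal{S}|=k$ and $A[\mathcal{S}]$ nonsingular. As long as there are $i\in\mathcal{S}$ and $j\in\{1,\ldots,n\}-\mathcal{S}$ such that $\mathcal{T}=(\mathcal{S}-\{i\})\cup\{j\}$ satisfies $\mathrm{vol}(A[\mathcal{T}])>\sqrt{\eta}\,\mathrm{vol}(A[\mathcal{S}])$, replace $\mathcal{S}$ by such a $\mathcal{T}$. When no such swap exists, output $A[\mathcal{S}]$. 1-interchange algorithm with additive relaxation factor $\theta_a\ge0$ for a set function $f$ on $\{1,\ldots,n\}$: start with a $k$-element set $\mathcal{S}$; while there are $x\in\mathcal{S}$ and $y\notin\mathcal{S}$ with $f((\mathcal{S}-\{x\})\cup\{y\})>f(\mathcal{S})+\theta_a$, replace $\mathcal{S}$ by $(\mathcal{S}-\{x\})\cup\{y\}$; output $\mathcal{S}$ when no such pair exists. Here $f(\mathcal{S})=\log\mathrm{vol}(A[\mathcal{S}])$. *)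

(* Defs.v *)
From mathcomp Require Import all_boot all_order all_algebra.
From mathcomp Require Import polyrcf.
From mathcomp Require Import reals exp.

Set Implicit Arguments.
Unset Strict Implicit.
Unset Printing Implicit Defensive.

Import Order.TTheory GRing.Theory Num.Theory.
Local Open Scope ring_scope.

Section Matrices.
Variables (R : realType) (n : nat).
Implicit Types (A : 'M[R]_n) (S : {set 'I_n}).

Definition posdef A :=
  A^T = A /\ forall x : 'cV[R]_n, x != 0 -> 0 < (x^T *m A *m x) 0 0.

(* The real eigenvalues of A with algebraic multiplicity, in nonincreasing
   order (rootsR enumerates the distinct real roots increasingly).  For a
   symmetric A all n eigenvalues are real. *)
Definition eigenvalues A : seq R :=
  let p := char_poly A in rev (flatten [seq nseq (mup x p) x | x <- rootsR p]).

(* Indexed from 1: lambda 1 A >= ... >= lambda n A. *)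
Definition lambda (i : nat) A : R := nth 0 (eigenvalues A) i.-1.

(* enum_val lists the elements of S in increasing order. *)
Definition principal_submx A S : 'M[R]_#|S| := mxsub enum_val enum_val A.

Definition vol A : R := `|\det A|.

(* ln 0 = 0 here rather than -oo; principal submatrices of a positive definite
   matrix have positive volume, so this value is not met there. *)
Definition logvol A : R := ln (vol A).

End Matrices.

(* A nondeterministic iterative algorithm on a finite set of states: it starts
   in any state satisfying [start], follows [step] while possible, and outputs
   the state in which no step is possible. *)
Record algorithm (T : finType) := Algorithm { start : pred T; step : rel T }.

Definition output (T : finType) (alg : algorithm T) (t : T) :=
  [exists t0, start alg t0 && connect (step alg) t0 t]
  && [forall u, ~~ step alg t u].

Definition same_algorithm (T : finType) (alg1 alg2 : algorithm T) :=
  start alg1 =1 start alg2 /\ step alg1 =2 step alg2.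

Definition swap (T : finType) (S : {set T}) (i j : T) : {set T} :=
  j |: (S :\ i).

Definition interchange1 (R : realType) (n k : nat) (f : {set 'I_n} -> R)
    (theta : R) : algorithm {set 'I_n} :=
  Algorithm
    (fun S : {set 'I_n} => #|S| == k)
    (fun S T : {set 'I_n} => [exists i in S, exists j in ~: S,
       (T == swap S i j) && (f S + theta < f T)]).

Definition strong_rrcholesky (R : realType) (n k : nat) (A : 'M[R]_n)
    (eta : R) : algorithm {set 'I_n} :=
  Algorithm
    (fun S : {set 'I_n} => (#|S| == k) && (principal_submx A S \in unitmx))
    (fun S T : {set 'I_n} => [exists i in S, exists j in ~: S,
       (T == swap S i j) &&
       (Num.sqrt eta * vol (principal_submx A S) < vol (principal_submx A T))]).

(* Main.v *)
Require Import Defs.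
From mathcomp Require Import all_boot all_order all_fingroup all_algebra.
From mathcomp Require Import complex polyrcf.
From mathcomp Require Import reals exp ring lra.

Set Implicit Arguments.
Unset Strict Implicit.
Unset Printing Implicit Defensive.

Import Order.TTheory GRing.Theory Num.Theory.
Local Open Scope ring_scope.

(** Divide [A] by its smallest eigenvalue [lambda n A] and put
    g(S) = log vol (A[S] / lambda n A).  On sets of a fixed size g differs from
    the log-volume by a constant, so both have the same maximizers and the same
    admissible swaps, and the bound to be proved is one about g:

      k g(O) <= (2 k - 1) g(S) + k^2 theta

    for a set S of size k that no swap improves by more than theta and any
    set O of size k.  This is the classical estimate for local search on
    an increasing submodular function with g(set0) = 0.  Fix x in S.
    Submodularity bounds the sum over y in O of the gains of adding y to S - x
    from below by g(O) - g(S - x) ([submodular_gain_sum]), while local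
    maximality bounds each gain by g(S) - g(S - x) + theta.  Summing over x in S
    and using that the losses g(S) - g(S - x) add up to at most g(S)
    ([submodular_loss_sum]) gives [local_max_bound].

    That g is increasing and submodular comes from one variational fact
    ([schur_complement]): for y outside S, the ratio det A[y |: S] / det A[S] is
    the Schur complement of A[S], and it is the minimum of w^T A w over the
    vectors w supported in y |: S with w_y = 1.  Enlarging S enlarges the set
    over which the minimum is taken, so the ratio decreases, which is
    submodularity of the log-volume.  Moreover w^T A w >= lambda_n |w|^2 >=
    lambda_n, so after division by lambda_n every ratio is at least 1 and g is
    increasing.

    The Rayleigh inequality used here requires that the [n]-th entry of the list
    of real roots of the characteristic polynomial really is the least
    eigenvalue, i.e. that this polynomial splits over the reals.  Both facts are
    read off from the unitary diagonalization of [A] over the complex numbers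
    ([symmetric_spectral], [lambda_min]). *)

(** * Local search for increasing submodular set functions *)

Lemma set_ind (T : finType) (P : {set T} -> Prop) :
  P set0 -> (forall x (U : {set T}), x \notin U -> P U -> P (x |: U)) ->
  forall U, P U.
Proof.
move=> P0 PU U; have [m] := ubnP #|U|; elim: m U => // m IHm U leUm.
have [-> //|[x xU]] := set_0Vmem U.
rewrite -(setD1K xU); apply: PU; first by rewrite !inE eqxx.
by apply: IHm; rewrite (cardsD1 x) xU in leUm.
Qed.

Lemma card_swap (T : finType) (S : {set T}) i j :
  i \in S -> j \notin S -> #|swap S i j| = #|S|.
Proof.
by move=> iS jS; rewrite cardsU1 !inE (negPf jS) andbF [RHS](cardsD1 i) iS.
Qed.

Section LocalSearch.
Variables (R : realFieldType) (T : finType) (g : {set T} -> R).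

Definition increasing := forall (U : {set T}) y, g U <= g (y |: U).

Definition submodular := forall (U V : {set T}) y,
  U \subset V -> y \notin V -> g (y |: V) - g V <= g (y |: U) - g U.

Lemma increasing_setU (U V : {set T}) : increasing -> g V <= g (U :|: V).
Proof.
move=> g_incr; elim/set_ind: U => [|x U _ IHU]; first by rewrite set0U.
by rewrite -setUA; apply: le_trans IHU (g_incr _ _).
Qed.

(** Adding the elements of [V] to [U] one by one, each gain is at most the gain
    of adding that element directly to [U]. *)
Lemma submodular_gain_sum (U V : {set T}) : submodular ->
  g (V :|: U) - g U <= \sum_(y in V) (g (y |: U) - g U).
Proof.
move=> g_sub; elim/set_ind: V => [|y V yV IHV].
  by rewrite set0U big_set0 subrr.
rewrite big_setU1 //= -setUA.
have [yU|yU] := boolP (y \in U).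
  have /setUidPr-> : [set y] \subset U by rewrite sub1set.
  have /setUidPr-> : [set y] \subset V :|: U by rewrite sub1set inE yU orbT.
  lra.
have yVU : y \notin V :|: U by rewrite inE negb_or yV.
have := g_sub _ _ y (subsetUr V U) yVU; lra.
Qed.

(** Building [V] up from the empty set, the element [x] contributes at least the
    loss caused by its removal from the whole of [V], and the contributions
    telescope. *)
Lemma submodular_loss_sum (V : {set T}) : submodular ->
  \sum_(x in V) (g V - g (V :\ x)) <= g V - g set0.
Proof.
move=> g_sub; elim/set_ind: V => [|z V zV IHV].
  by rewrite big_set0 subrr.
rewrite big_setU1 //= setU1K //.
have le_loss : \sum_(x in V) (g (z |: V) - g ((z |: V) :\ x))
             <= \sum_(x in V) (g V - g (V :\ x)).
  apply: ler_sum => x xV.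
  have := g_sub (V :\ x) ((z |: V) :\ x) x (setSD _ (subsetUr _ _)).
  by rewrite !setD1K ?inE ?xV ?orbT ?eqxx //=; apply.
lra.
Qed.

(** Double counting over all pairs in [S] x [O]: pairs that are not genuine swaps
    ([y] in [S]) satisfy the same inequality because [g] is increasing. *)
Lemma local_max_bound (S O : {set T}) k theta :
  increasing -> submodular -> g set0 = 0 -> 0 <= theta ->
  #|S| = k -> #|O| = k ->
  (forall i j, i \in S -> j \notin S -> g (swap S i j) <= g S + theta) ->
  k%:R * g O <= (2 * k%:R - 1) * g S + k%:R ^+ 2 * theta.
Proof.
move=> g_incr g_sub g0 theta_ge0 cardS cardO S_max.
have swap_le x y : x \in S ->
    g (y |: S :\ x) - g (S :\ x) <= g S - g (S :\ x) + theta.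
  move=> xS; have := g_incr (S :\ x) x; rewrite setD1K // => gSx.
  have [yS|yS] := boolP (y \in S); last first.
    by have := S_max x y xS yS; rewrite /swap; lra.
  have [->|yx] := eqVneq y x; first by rewrite setD1K //; lra.
  have -> : y |: S :\ x = S :\ x by apply/setUidPr; rewrite sub1set !inE yx.
  lra.
(* For each fixed x, sum over y in O. *)
have loss_le x : x \in S ->
    g O - g (S :\ x) <= k%:R * (g S - g (S :\ x) + theta).
  move=> xS; rewrite -cardO mulr_natl -sumr_const.
  apply: le_trans (ler_sum _ (fun y _ => swap_le x y xS)).
  apply: le_trans (submodular_gain_sum (S :\ x) O g_sub).
  by rewrite lerD2r setUC increasing_setU.
have : \sum_(x in S) (g O - g (S :\ x))
      <= \sum_(x in S) (k%:R * (g S - g (S :\ x) + theta)) by exact: ler_sum.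
set loss := \sum_(x in S) (g S - g (S :\ x)).
have -> : \sum_(x in S) (g O - g (S :\ x)) = k%:R * (g O - g S) + loss.
  rewrite -cardS mulr_natl -sumr_const -big_split /=.
  by apply: eq_bigr => x _; lra.
have -> : \sum_(x in S) (k%:R * (g S - g (S :\ x) + theta))
    = k%:R * (loss + k%:R * theta).
  by rewrite -mulr_sumr big_split /= sumr_const cardS -[theta *+ k]mulr_natl.
have := submodular_loss_sum S g_sub; rewrite -/loss g0 subr0 => loss_le_g.
have [k0 _|k_gt0] := posnP k.
  have S0 : S = set0 by apply/eqP; rewrite -cards_eq0 cardS k0.
  by rewrite S0 g0 k0; lra.
(* Of the k copies of the total loss one cancels against the sum over x of
   g(S - x), which leaves the factor k - 1. *)
have : (k%:R - 1) * loss <= (k%:R - 1) * g S :> R.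
  by rewrite ler_wpM2l // subr_ge0 ler1n.
nra.
Qed.

End LocalSearch.

(** * Schur complements as minima of the quadratic form *)

Section SchurComplement.
Variables (R : realType) (n : nat).
Implicit Types (A : 'M[R]_n) (S : {set 'I_n}).

(** Principal minors do not depend on the enumeration of the index set: changing
    it permutes rows and columns by the same permutation, and the two signs
    cancel.  This allows a new index to be put first instead of at its place in
    the increasing order. *)
Lemma det_mxsub_inj m (f : 'I_m -> 'I_n) A S : injective f ->
  f @: setT = S -> \det (mxsub f f A) = \det (principal_submx A S).
Proof.
move=> f_inj imf.
have mS : m = #|S| by rewrite -imf card_imset // cardsT card_ord.
case: _ / (esym mS) in f f_inj imf *.
have fS i : f i \in S by rewrite -imf imset_f.
pose s i := enum_rank_in (fS i) (f i).
have sE i : enum_val (s i) = f i by rewrite enum_rankK_in.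
have s_inj : injective s by move=> i j sij; apply: f_inj; rewrite -!sE sij.
rewrite /principal_submx; set B := mxsub enum_val enum_val A.
have -> : mxsub f f A = row_perm (perm s_inj) (col_perm (perm s_inj) B).
  by apply/matrixP => i j; rewrite !mxE !permE !sE.
rewrite row_permE col_permE !det_mulmx !det_perm.
by rewrite odd_permV mulrCA -signr_addb addbb mulr1.
Qed.

Lemma det_principal_submx0 A : \det (principal_submx A set0) = 1.
Proof.
rewrite /principal_submx; move: (enum_val (A := _)); rewrite cards0 => f.
exact: det_mx00.
Qed.

(** With v the solution of A[S] v = A[S, y], the vector w = e_y - v (v being
    extended by zero outside [S]) satisfies w^T A w = A_yy - A[y, S] v, the Schur
    complement of A[S].  Since A w vanishes on [S], w is a critical point of the
    quadratic form among the vectors that agree with it outside [S]. *)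
Lemma schur_witness A S y :
  A^T = A -> y \notin S -> principal_submx A S \in unitmx ->
  exists w : 'cV[R]_n,
    [/\ w y 0 = 1,
        forall i, i \notin y |: S -> w i 0 = 0,
        forall i, i \in S -> (A *m w) i 0 = 0
      & \det (principal_submx A (y |: S))
        = \det (principal_submx A S) * (w^T *m A *m w) 0 0].
Proof.
move=> A_sym yS; set B := principal_submx A S => B_unit.
pose f (i : 'I_(1 + #|S|)) := if split i is inr j then enum_val j else y.
have fl : f (lshift _ 0) = y by rewrite /f (unsplitK (inl _)).
have fr j : f (rshift 1 j) = enum_val j by rewrite /f (unsplitK (inr _)).
have f_inj : injective f.
  have yN (j : 'I_#|S|) : y <> enum_val j.
    by move=> yE; move/negP: yS; apply; rewrite yE; exact: enum_valP.
  move=> i j; case: (split_ordP i) => i' ->; case: (split_ordP j) => j' ->;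
    rewrite ?(ord1 i') ?(ord1 j') ?fl ?fr // => e.
  - by case: (yN j').
  - by case: (yN i').
  - by rewrite (enum_val_inj e).
have imf : f @: setT = y |: S.
  apply/setP => i; rewrite !inE; apply/imsetP/orP => [[j _ ->]|[/eqP ->|iS]].
  - case: (split_ordP j) => j' ->; rewrite ?(ord1 j') ?fl ?fr ?eqxx; first by left.
    by right; exact: enum_valP.
  - by exists (lshift _ 0); rewrite ?fl.
  - by exists (rshift 1 (enum_rank_in iS i)); rewrite ?fr ?enum_rankK_in.
pose c : 'cV[R]_#|S| := \col_j A (enum_val j) y.
have Af : mxsub f f A = block_mx (A y y)%:M c^T c B.
  apply/matrixP => i j; case: (split_ordP i) => i' ->; case: (split_ordP j) => j' ->.
  - by rewrite block_mxEul !ord1 !mxE fl.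
  - by rewrite block_mxEur !ord1 !mxE fl fr -[in LHS]A_sym mxE.
  - by rewrite block_mxEdl !ord1 !mxE fl fr.
  - by rewrite block_mxEdr !mxE !fr.
pose v := invmx B *m c; pose z : 'cV[R]_(1 + #|S|) := col_mx 1%:M (- v).
(* E embeds vectors indexed by y and S into those indexed by 'I_n. *)
pose E : 'M[R]_(n, 1 + #|S|) := colsub f 1%:M.
have EtM m (M : 'M_(n, m)) : E^T *m M = rowsub f M.
  by rewrite trmx_mxsub trmx1 mul_rowsub_mx mul1mx.
have ME m (M : 'M_(m, n)) : M *m E = colsub f M by rewrite mulmx_colsub mulmx1.
have Ez i : (E *m z) (f i) 0 = z i 0.
  transitivity (rowsub f (E *m z) i 0); first by rewrite [RHS]mxE.
  rewrite -EtM mulmxA EtM.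
  suff -> : rowsub f E = 1%:M by rewrite mul1mx.
  by apply/matrixP => a b; rewrite !mxE (inj_eq f_inj).
have Bv : B *m v = c by rewrite mulKVmx.
have Cz : mxsub f f A *m z = col_mx ((A y y)%:M - c^T *m v) 0.
  by rewrite Af mul_block_col !mulmx1 !mulmxN Bv subrr.
have EAE : E^T *m A *m E = mxsub f f A.
  by rewrite EtM ME; apply/matrixP => a b; rewrite !mxE.
exists (E *m z); split=> [|i iN|i iS|].
- by rewrite -fl Ez col_mxEu mxE eqxx.
- rewrite mxE big1 // => j _; rewrite !mxE.
  case: eqP => [iE|]; last by rewrite mul0r.
  by rewrite -imf iE imset_f in iN.
- have -> : i = f (rshift 1 (enum_rank_in iS i)) by rewrite fr enum_rankK_in.
  set j := rshift _ _.
  have -> : (A *m (E *m z)) (f j) 0 = (E^T *m (A *m (E *m z))) j 0.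
    by rewrite EtM [RHS]mxE.
  by rewrite !mulmxA EAE Cz col_mxEd mxE.
rewrite -(det_mxsub_inj A f_inj imf).
have -> : (E *m z)^T *m A *m (E *m z) = z^T *m (mxsub f f A *m z).
  by rewrite -EAE trmx_mul !mulmxA.
rewrite Cz tr_col_mx mul_row_col mulmx0 addr0 trmx1 mul1mx.
(* Clear the column A[S, y] by adding to it the columns of A[S]
   with coefficients - v. *)
have det_L : \det (block_mx 1%:M 0 (- v) 1%:M : 'M_(1 + #|S|)) = 1.
  by rewrite det_lblock !det1 mulr1.
rewrite -[LHS]mulr1 -det_L -det_mulmx Af mulmx_block !mulmx1 !mulmx0 !add0r.
have -> : c + B *m - v = 0 by rewrite mulmxN Bv subrr.
by rewrite det_ublock det_mx11 mulmxN mulrC.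
Qed.

End SchurComplement.

Section PositiveDefinite.
Variables (R : realType) (n : nat) (A : 'M[R]_n).
Hypothesis A_pd : posdef A.
Implicit Types (S U V : {set 'I_n}).

Local Notation quad x := ((x^T *m A *m x) 0 0).

Lemma posdef_ge0 (x : 'cV_n) : 0 <= quad x.
Proof.
have [->|/(proj2 A_pd)/ltW //] := eqVneq x 0.
by rewrite mulmx0 mxE.
Qed.

Lemma det_principal_submx_gt0 S : 0 < \det (principal_submx A S).
Proof.
elim/set_ind: S => [|y S yS IHS].
  by rewrite det_principal_submx0.
have S_unit : principal_submx A S \in unitmx by rewrite unitmxE unitfE gt_eqF.
have [w [wy _ _ ->]] := schur_witness (proj1 A_pd) yS S_unit.
rewrite mulr_gt0 //; apply: (proj2 A_pd); apply/eqP => w0.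
by move/eqP: wy; rewrite w0 mxE eq_sym oner_eq0.
Qed.

(** A competitor u is w + h with h supported in [S], hence orthogonal to A w, so
    that u^T A u = w^T A w + h^T A h. *)
Lemma schur_complement S y : y \notin S ->
  exists w : 'cV[R]_n,
    [/\ w y 0 = 1, forall i, i \notin y |: S -> w i 0 = 0,
        \det (principal_submx A (y |: S)) = \det (principal_submx A S) * quad w
      & forall u : 'cV[R]_n, u y 0 = 1 -> (forall i, i \notin y |: S -> u i 0 = 0) ->
        quad w <= quad u].
Proof.
move=> yS; have A_sym := proj1 A_pd.
have S_unit : principal_submx A S \in unitmx.
  by rewrite unitmxE unitfE gt_eqF // det_principal_submx_gt0.
have [w [wy wN Aw detE]] := schur_witness A_sym yS S_unit.
exists w; split=> // u uy uN; pose h := u - w.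
have hAw : (h^T *m A *m w) 0 0 = 0.
  rewrite -mulmxA mxE big1 // => i _; rewrite mxE.
  have [iS|iS] := boolP (i \in S); first by rewrite Aw // mulr0.
  suff -> : h i 0 = 0 by rewrite mul0r.
  rewrite !mxE; have [->|iy] := eqVneq i y; first by rewrite uy wy subrr.
  by rewrite uN ?wN ?subrr // !inE negb_or iy.
have wAh : (w^T *m A *m h) 0 0 = 0.
  have -> : w^T *m A *m h = (h^T *m A *m w)^T.
    by rewrite !trmx_mul trmxK A_sym mulmxA.
  by rewrite [LHS]mxE.
have -> : u = w + h by rewrite addrC subrK.
clearbody h.
have entryD (M N : 'M[R]_1) : (M + N) 0 0 = M 0 0 + N 0 0 by rewrite mxE.
have -> : (w + h)^T = w^T + h^T by rewrite linearD.
rewrite 2!mulmxDl !mulmxDr !entryD hAw wAh addr0 add0r lerDl.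
exact: posdef_ge0.
Qed.

End PositiveDefinite.

(** * The least eigenvalue *)

Section Roots.
Variable R : rcfType.

Lemma mup_prod_XsubC (rs : seq R) x :
  mup x (\prod_(z <- rs) ('X - z%:P)) = count_mem x rs.
Proof.
elim: rs => [|z rs IHrs] /=; first by rewrite big_nil mupNroot ?root1.
rewrite big_cons mupM ?polyXsubC_eq0 ?monic_neq0 ?monic_prod_XsubC // IHrs.
by rewrite -[_ - _]expr1 mup_XsubCX; case: eqP.
Qed.

Lemma perm_roots_mup (rs : seq R) (p := \prod_(z <- rs) ('X - z%:P)) :
  perm_eq (flatten [seq nseq (mup x p) x | x <- rootsR p]) rs.
Proof.
have p_neq0 : p != 0 by rewrite monic_neq0 ?monic_prod_XsubC.
apply: perm_trans (perm_count_undup rs).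
under eq_map => x do rewrite mup_prod_XsubC.
apply/perm_flatten/perm_map/uniq_perm; rewrite ?undup_uniq ?uniq_roots //.
by move=> x; rewrite -roots_on_rootsR //= root_prod_XsubC mem_undup.
Qed.

(** Stated for the list that defines [eigenvalues]: for a polynomial that splits
    over [R], its last entry is a genuine root and not the default value 0. *)
Lemma last_eigenvalue_min n (rs : seq R) (p := \prod_(z <- rs) ('X - z%:P))
  (l := nth 0 (rev (flatten [seq nseq (mup x p) x | x <- rootsR p])) (size rs).-1) :
  size rs = n.+1 ->
  l \in rs /\ {in rs, forall x, l <= x}.
Proof.
move=> sz_rs; have p_neq0 : p != 0 by rewrite monic_neq0 ?monic_prod_XsubC.
have perm_rs := perm_roots_mup rs; rewrite -/p in perm_rs.
rewrite /l nth_rev (perm_size perm_rs) sz_rs // subnn.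
have rsE x : (x \in rootsR p) = (x \in rs).
  by rewrite -roots_on_rootsR //= root_prod_XsubC.
have := sorted_roots (- cauchy_bound p) (cauchy_bound p) p.
rewrite -/(rootsR p); case: (rootsR p) rsE => [rsE _|x r rsE].
  by case: (rs) sz_rs rsE => // z rs' _ /(_ z); rewrite mem_head.
rewrite /= lt_path_sortedE => /andP[/allP ltx _].
have xrs : x \in rs by rewrite -rsE mem_head.
have : (0 < mup x p)%N by rewrite mup_prod_XsubC -has_count has_pred1.
case: (mup x p) => //= m _; split=> // y.
by rewrite -rsE inE => /predU1P[-> //|/ltx/ltW].
Qed.

End Roots.

Lemma similar_char_poly (R : comUnitRingType) m (P A B : 'M[R]_m) : P \in unitmx ->
  A = invmx P *m B *m P -> char_poly A = char_poly B.
Proof.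
move=> Pu AE; rewrite /char_poly.
have -> : char_poly_mx A =
    map_mx polyC (invmx P) *m char_poly_mx B *m map_mx polyC P.
  rewrite /char_poly_mx AE !map_mxM mulmxBr mulmxBl; congr (_ - _).
  by rewrite mul_mx_scalar -scalemxAl -map_mxM mulVmx // map_mx1 scalemx1.
rewrite !det_mulmx mulrAC mulrC -[RHS]mulr1; congr (_ * _).
by rewrite -det_mulmx -map_mxM mulVmx // map_mx1 det1.
Qed.

Section Spectral.
Local Open Scope complex_scope.
Local Open Scope sesquilinear_scope.
Variables (R : rcfType) (n : nat).

(** Over the complex numbers A = P^-1 D P with P unitary and D real diagonal.  The
    factorization of the characteristic polynomial descends to the reals, and
    with y = P x the form x^T A x becomes the sum of the d_i |y_i|^2, where the
    |y_i|^2 add up to x^T x. *)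
Lemma symmetric_spectral (A : 'M[R]_n) : A^T = A ->
  exists d : 'I_n -> R, char_poly A = \prod_i ('X - (d i)%:P)
    /\ forall m, (forall i, m <= d i) ->
       forall x : 'cV_n, m * (x^T *m x) 0 0 <= (x^T *m A *m x) 0 0.
Proof.
move=> A_sym; pose toC := real_complex R; pose AC := map_mx toC A.
have AC_herm : AC \is hermsymmx.
  apply: realsym_hermsym.
    by apply/is_hermitianmxP; rewrite expr0 scale1r map_mx_id // map_trmx A_sym.
  by apply/mxOverP => i j; rewrite mxE; apply/complex_realP; exists (A i j).
pose P := spectralmx AC; have P_unitary : P \is unitarymx := spectral_unitarymx AC.
have AC_diag : AC = invmx P *m diag_mx (spectral_diag AC) *m P.
  by apply/orthomx_spectralP/hermitian_normalmx.
pose d i := complex.Re (spectral_diag AC 0 i).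
have dE i : spectral_diag AC 0 i = (d i)%:C.
  by rewrite RRe_real // (mxOverP (hermitian_spectral_diag_real AC_herm)).
exists d; split=> [|m m_le x].
  apply: (map_poly_inj toC); rewrite map_char_poly.
  rewrite (similar_char_poly (spectral_unit AC) AC_diag).
  rewrite char_poly_trig ?diag_mx_is_trig // rmorph_prod.
  apply: eq_bigr => i _.
  by rewrite mxE eqxx mulr1n dE rmorphB /= map_polyX map_polyC.
pose xC := map_mx toC x; pose y := P *m xC.
have xCt : map_mx toC x^T = xC^t*.
  by apply/matrixP => i j; rewrite !mxE; exact/esym/conjc_real.
have yt : y^t* = xC^t* *m P^t* by rewrite trmx_mul map_mxM.
have sq_norm : toC ((x^T *m x) 0 0) = \sum_i `|y i 0| ^+ 2.
  have -> : toC ((x^T *m x) 0 0) = (map_mx toC (x^T *m x)) 0 0 by rewrite [RHS]mxE.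
  have -> : map_mx toC (x^T *m x) = y^t* *m y.
    rewrite map_mxM xCt yt mulmxA -[_ *m _ *m P]mulmxA -invmx_unitary //.
    by rewrite mulVmx ?mulmx1 // unitarymx_unit.
  by rewrite mxE; apply: eq_bigr => i _; rewrite !mxE normCKC.
have quad : toC ((x^T *m A *m x) 0 0) = \sum_i toC (d i) * `|y i 0| ^+ 2.
  have -> : toC ((x^T *m A *m x) 0 0) = (map_mx toC (x^T *m A *m x)) 0 0.
    by rewrite [RHS]mxE.
  have -> : map_mx toC (x^T *m A *m x) = y^t* *m (diag_mx (spectral_diag AC) *m y).
    by rewrite 2!map_mxM xCt yt -/AC [in LHS]AC_diag invmx_unitary // !mulmxA.
  rewrite mxE; apply: eq_bigr => i _.
  by rewrite mul_diag_mx !mxE dE normCKC mulrCA.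
rewrite -lecR rmorphM /= -/toC sq_norm quad mulr_sumr.
by apply: ler_sum => i _; rewrite ler_wpM2r ?exprn_ge0 // lecR.
Qed.

End Spectral.

Section Lambda.
Variables (R : realType) (n : nat).

Lemma lambda_min (A : 'M[R]_n) : posdef A -> (0 < n)%N ->
  0 < lambda n A
  /\ forall x : 'cV_n, lambda n A * (x^T *m x) 0 0 <= (x^T *m A *m x) 0 0.
Proof.
case: n A => // m A [A_sym A_pos] _.
have [d [char_A rayleigh]] := symmetric_spectral A_sym.
pose rs := [seq d i | i <- enum 'I_m.+1].
have char_rs : char_poly A = \prod_(z <- rs) ('X - z%:P).
  by rewrite char_A big_map big_enum.
have sz_rs : size rs = m.+1 by rewrite size_map size_enum_ord.
have [] := last_eigenvalue_min sz_rs.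
rewrite -char_rs sz_rs -/(eigenvalues A) -/(lambda m.+1 A) => l_rs l_min.
split; last by apply: rayleigh => i; rewrite l_min // map_f // mem_enum.
have /eigenvalueP[v vA v_neq0] : eigenvalue A (lambda m.+1 A).
  by rewrite eigenvalue_root_char char_rs root_prod_XsubC.
have vT_neq0 : v^T != 0 by rewrite trmx_eq0.
have := A_pos _ vT_neq0; rewrite trmxK vA -scalemxAl mxE ltNge.
apply: contraNT; rewrite -leNgt => l_le0; rewrite mulr_le0_ge0 //.
by rewrite mxE; apply: sumr_ge0 => i _; rewrite !mxE -expr2 sqr_ge0.
Qed.

End Lambda.

(** * The log-volume as a set function *)

Section LogVolume.
Variables (R : realType) (n : nat) (A : 'M[R]_n).
Hypotheses (A_pd : posdef A) (n_gt0 : (0 < n)%N).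

Let lam_gt0 : 0 < lambda n A := (lambda_min A_pd n_gt0).1.

Lemma vol_principal_submx (S : {set 'I_n}) :
  vol (principal_submx A S) = \det (principal_submx A S).
Proof. by rewrite /vol gtr0_norm // det_principal_submx_gt0. Qed.

(** The scaling by the least eigenvalue is what makes this function increasing;
    [logvol] itself need not be. *)
Definition scaled_logvol (S : {set 'I_n}) :=
  logvol ((lambda n A)^-1 *: principal_submx A S).

Lemma scaled_logvol_principal_submx S :
  scaled_logvol S = logvol (principal_submx A S) - #|S|%:R * ln (lambda n A).
Proof.
have det_gt0 := det_principal_submx_gt0 A_pd S.
rewrite /scaled_logvol /logvol vol_principal_submx /vol detZ gtr0_norm; last first.
  by rewrite mulr_gt0 ?exprn_gt0 ?invr_gt0.
rewrite lnM ?posrE ?exprn_gt0 ?invr_gt0 // addrC; congr (_ + _).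
by rewrite lnXn ?invr_gt0 // lnV ?posrE // mulNrn mulr_natl.
Qed.

Lemma scaled_logvol0 : scaled_logvol set0 = 0.
Proof.
by rewrite scaled_logvol_principal_submx /logvol vol_principal_submx det_principal_submx0 ln1 cards0 mul0r subr0.
Qed.

Lemma scaled_logvol_gain (S : {set 'I_n}) y (w : 'cV[R]_n) (yS : y \notin S) :
  0 < (w^T *m A *m w) 0 0 ->
  \det (principal_submx A (y |: S))
    = \det (principal_submx A S) * (w^T *m A *m w) 0 0 ->
  scaled_logvol (y |: S) - scaled_logvol S
    = ln ((w^T *m A *m w) 0 0) - ln (lambda n A).
Proof.
move=> quad_gt0 detE; rewrite !scaled_logvol_principal_submx /logvol !vol_principal_submx detE.
rewrite lnM ?posrE ?det_principal_submx_gt0 // cardsU1 yS natrD.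
by rewrite /=; ring.
Qed.

(** |w|^2 >= w_y^2 = 1 in the Rayleigh inequality. *)
Lemma quad_ge_lambda (w : 'cV[R]_n) y :
  w y 0 = 1 -> lambda n A <= (w^T *m A *m w) 0 0.
Proof.
move=> wy; apply: le_trans ((lambda_min A_pd n_gt0).2 w).
rewrite ler_pMr // mxE (bigD1 y) //= !mxE wy mulr1 lerDl.
by apply: sumr_ge0 => i _; rewrite !mxE -expr2 sqr_ge0.
Qed.

Lemma increasing_scaled_logvol : increasing scaled_logvol.
Proof.
move=> S y; have [yS|yS] := boolP (y \in S).
  by have -> : y |: S = S by apply/setUidPr; rewrite sub1set.
have [w [wy _ detE _]] := schur_complement A_pd yS.
have le_w := quad_ge_lambda wy.
have w_gt0 := lt_le_trans lam_gt0 le_w.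
by rewrite -subr_ge0 (scaled_logvol_gain yS w_gt0 detE) subr_ge0 ler_ln ?posrE.
Qed.

(** The minimizer for the smaller set [S] is a competitor for the larger one. *)
Lemma submodular_scaled_logvol : submodular scaled_logvol.
Proof.
move=> S T y ST yT.
have yS : y \notin S by apply: contraNN yT; apply: (subsetP ST).
have [u [uy uN detS _]] := schur_complement A_pd yS.
have [w [wy _ detT w_min]] := schur_complement A_pd yT.
have u_gt0 := lt_le_trans lam_gt0 (quad_ge_lambda uy).
have w_gt0 := lt_le_trans lam_gt0 (quad_ge_lambda wy).
rewrite (scaled_logvol_gain yS u_gt0 detS) (scaled_logvol_gain yT w_gt0 detT).
rewrite lerD2r ler_ln ?posrE //; apply: w_min => // i iN; apply: uN.
by apply: contraNN iN; apply/subsetP/setUS.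
Qed.

End LogVolume.

(** * The strong rank-revealing Cholesky selection *)

Theorem theorem6p6 (R : realType) (n k : nat) (A : 'M[R]_n) (eta : R)
    (Apd : posdef A) (k_gt0 : (0 < k)%N) (k_lt_n : (k < n)%N) (eta_gt1 : 1 < eta)
    (Sstar : {set 'I_n}) (card_Sstar : #|Sstar| = k)
    (Sstar_max : forall T : {set 'I_n}, #|T| = k ->
       logvol (principal_submx A T) <= logvol (principal_submx A Sstar)) :
  same_algorithm
    (strong_rrcholesky k A eta)
    (interchange1 k (fun S => logvol (principal_submx A S)) (ln (Num.sqrt eta)))
  /\ (forall S : {set 'I_n}, output (strong_rrcholesky k A eta) S ->
        0 <= logvol (principal_submx A Sstar) - logvol (principal_submx A S)
        /\ logvol (principal_submx A Sstar) - logvol (principal_submx A S)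
           <= (k%:R - 1) / (2 * k%:R - 1)
                * logvol ((lambda n A)^-1 *: principal_submx A Sstar)
              + k%:R ^+ 2 / (2 * k%:R - 1) * ln (Num.sqrt eta))
  /\ (k%:R - 1) / (2 * k%:R - 1) < 1 / 2 :> R
  /\ k%:R ^+ 2 / (2 * k%:R - 1) <= k%:R :> R.
Proof.
have n_gt0 : (0 < n)%N := leq_ltn_trans (leq0n k) k_lt_n.
have vol_gt0 S : 0 < vol (principal_submx A S).
  by rewrite vol_principal_submx ?det_principal_submx_gt0.
have sqrt_gt1 : 1 < Num.sqrt eta by rewrite -sqrtr1 ltr_sqrt // (lt_trans ltr01).
have sqrt_gt0 : 0 < Num.sqrt eta := lt_trans ltr01 sqrt_gt1.
have k_ge1 : 1 <= k%:R :> R by rewrite ler1n.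
have swap_testE S T :
    (logvol (principal_submx A S) + ln (Num.sqrt eta) < logvol (principal_submx A T))
    = (Num.sqrt eta * vol (principal_submx A S) < vol (principal_submx A T)).
  by rewrite addrC -lnM ?posrE // ltr_ln ?posrE // mulr_gt0.
split.
  split=> [S|S T] /=.
    by rewrite unitmxE unitfE lt0r_neq0 ?andbT // det_principal_submx_gt0.
  apply: eq_existsb => i; congr (_ && _); apply: eq_existsb => j.
  by rewrite swap_testE.
split; last split.
- move=> S /andP[/existsP[S0 /andP[/andP[/eqP cardS0 _] S0S]] /forallP S_stop].
  have cardS : #|S| = k.
    have card_step : closed (step (strong_rrcholesky k A eta))
        [pred U : {set 'I_n} | #|U| == k].
      move=> U V /existsP[i /andP[iU /existsP[j /andP[jU /andP[/eqP -> _]]]]].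
      by rewrite !inE card_swap // -in_setC.
    by apply/eqP; rewrite -[_ == _](closed_connect card_step S0S) inE cardS0.
  split; first by rewrite subr_ge0 Sstar_max.
  have S_max i j : i \in S -> j \notin S ->
      scaled_logvol A (swap S i j) <= scaled_logvol A S + ln (Num.sqrt eta).
    move=> iS jS; have := S_stop (swap S i j); rewrite /= => /existsPn/(_ i).
    rewrite iS /= => /existsPn/(_ j); rewrite inE jS eqxx /= -swap_testE -leNgt.
    rewrite !scaled_logvol_principal_submx //.
    have -> : #|swap S i j|%:R = #|S|%:R :> R by rewrite card_swap.
    lra.
  have theta_ge0 : 0 <= ln (Num.sqrt eta) by rewrite ln_ge0 // ltW.
  have := local_max_bound (increasing_scaled_logvol Apd n_gt0)
    (submodular_scaled_logvol Apd n_gt0) (scaled_logvol0 Apd n_gt0) theta_ge0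
    cardS card_Sstar S_max.
  rewrite -/(scaled_logvol A Sstar).
  have -> : logvol (principal_submx A Sstar) - logvol (principal_submx A S)
      = scaled_logvol A Sstar - scaled_logvol A S.
    rewrite !scaled_logvol_principal_submx //.
    have -> : #|S|%:R = #|Sstar|%:R :> R by rewrite cardS card_Sstar.
    lra.
  move=> bound.
  rewrite mulrAC [X in _ <= _ + X]mulrAC -mulrDl ler_pdivlMr; last by lra.
  lra.
- rewrite ltr_pdivrMr; lra.
- rewrite ler_pdivrMr; nra.
Qed.
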